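(* (1) There exist a Boolean function $f:\mathbb{F}_2^n\to\{-1,1\}$ and distinct $\alpha,\beta\in\mathcal{S}$ such that $|O_{\alpha+\gamma}|=2$ for all $\gamma\in\mathcal{S}\setminus\{\alpha,\beta\}$. (2) Let $f:\mathbb{F}_2^n\to\{-1,1\}$ be any Boolean function. If there exist distinct $\alpha,\beta\in\mathcal{S}$ such that $|O_{\alpha+\gamma}|=2$ for all $\gamma\in\mathcal{S}\setminus\{\alpha,\beta\}$, then $|O_{\alpha+\beta}|=k/2$.
   Context: For $\alpha\in\mathbb{F}_2^n$ let $\chi_\alpha(x)=(-1)^{\sum_i\alpha_ix_i}$; every $f:\mathbb{F}_2^n\to\mathbb{R}$ is uniquely $f=\sum_\alpha\widehat f(\alpha)\chi_\alpha$. The Fourier support of $f$ is $\mathcal{S}=\{\alpha:\widehat f(\alpha)\ne0\}$ and $k=|\mathcal{S}|$. For $\gamma\in\mathbb{F}_2^n$, $O_\gamma$ is the set of unordered pairs $\{\alpha_1,\alpha_2\}$ of distinct elements of $\mathcal{S}$ with $\alpha_1+\alpha_2=\gamma$. *)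

(* Defs.v *)
From mathcomp Require Import all_boot all_order all_algebra.
From mathcomp Require Import reals.

Set Implicit Arguments.
Unset Strict Implicit.
Unset Printing Implicit Defensive.

Import GRing.Theory Num.Theory.

Local Open Scope ring_scope.

(* The exponent is computed in 'F_2 and then read as its representative
   0 or 1 in nat. *)
Definition chi (R : realType) (n : nat) (a x : 'rV['F_2]_n) : R :=
  (-1) ^+ (\sum_i a 0 i * x 0 i : 'F_2)%R.

(* Lemmas [fourier_expansion] and [fourier_unique] below show that these are
   the unique coefficients c with f = \sum_a c a * chi a. *)
Definition fourier (R : realType) (n : nat) (f : 'rV['F_2]_n -> R)
  (a : 'rV['F_2]_n) : R := (2 ^+ n)^-1 * \sum_x f x * chi R a x.

Definition fourier_support (R : realType) (n : nat) (f : 'rV['F_2]_n -> R) :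
  {set 'rV['F_2]_n} := [set a | fourier f a != 0].

Definition boolean_valued (R : realType) (n : nat) (f : 'rV['F_2]_n -> R) :
  Prop := forall x, f x = -1 \/ f x = 1.

(* Unordered pairs are encoded as two-element sets. *)
Definition pairs_summing_to (R : realType) (n : nat) (f : 'rV['F_2]_n -> R)
  (g : 'rV['F_2]_n) : {set {set 'rV['F_2]_n}} :=
  [set [set a1; a2] | a1 in fourier_support f, a2 in fourier_support f
     & (a1 != a2) && (a1 + a2 == g)].

Lemma F2P (u : 'F_2) : u = 0 \/ u = 1.
Proof.
by case: u => [[|[|m]] hm] //; [left | right]; apply: val_inj.
Qed.

Lemma chiC (R : realType) n (a x : 'rV['F_2]_n) : chi R a x = chi R x a.
Proof. by rewrite /chi; under eq_bigr do rewrite mulrC. Qed.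

Lemma chiDr (R : realType) n (a x y : 'rV['F_2]_n) :
  chi R a (x + y) = chi R a x * chi R a y.
Proof.
rewrite /chi; under eq_bigr do rewrite mxE mulrDr.
rewrite big_split /=.
case: (F2P (\sum_i a 0 i * x 0 i)) => ->;
case: (F2P (\sum_i a 0 i * y 0 i)) => -> /=;
by rewrite ?addr0 ?add0r ?expr0 ?expr1 ?mulr1 ?mul1r ?mulrNN ?mulr1.
Qed.

Lemma chi_delta (R : realType) n (a : 'rV['F_2]_n) i :
  a 0 i != 0 -> chi R a (delta_mx 0 i) = -1.
Proof.
move=> ai; rewrite /chi (bigD1 i) //= big1 => [|j ji].
  by case: (F2P (a 0 i)) ai => -> //; rewrite !mxE !eqxx.
by rewrite mxE (negPf ji) andbF mulr0.
Qed.

Lemma sum_chi (R : realType) n (a : 'rV['F_2]_n) :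
  \sum_x chi R a x = (2 ^+ n) *+ (a == 0).
Proof.
have [->|/rV0Pn[i ai]] := eqVneq a 0.
  rewrite (eq_bigr (fun=> 1)) => [|x _]; last first.
    by rewrite /chi big1 // => i _; rewrite mxE mul0r.
  by rewrite sumr_const card_mx card_Fp // mul1n natrX.
rewrite mulr0n; set S := LHS; suff: S *+ 2 == 0 by rewrite mulrn_eq0 => /eqP.
apply/eqP; rewrite mulr2n /S.
rewrite {1}(reindex_inj (addrI (delta_mx 0 i))) /= -big_split big1 //= => x _.
by rewrite chiDr chi_delta // mulN1r addNr.
Qed.

Lemma chi_orthogonal (R : realType) n (x y : 'rV['F_2]_n) :
  \sum_a chi R a x * chi R a y = (2 ^+ n) *+ (x == y).
Proof.
under eq_bigr do rewrite -chiDr chiC.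
rewrite sum_chi addr_eq0; congr (_ *+ (_ == _)).
by apply/rowP => i; rewrite mxE; case: (F2P (y 0 i)) => ->; apply: val_inj.
Qed.

Lemma fourier_expansion (R : realType) n (f : 'rV['F_2]_n -> R) x :
  f x = \sum_a fourier f a * chi R a x.
Proof.
transitivity ((2 ^+ n)^-1 * \sum_y f y * \sum_a chi R a y * chi R a x).
  rewrite (bigD1 x) //= [X in _ + X]big1 => [|y yx].
    rewrite chi_orthogonal eqxx addr0 mulr1n mulrCA mulVf ?mulr1 //.
    by rewrite expf_neq0 // pnatr_eq0.
  by rewrite chi_orthogonal (negPf yx) mulr0.
under [in LHS]eq_bigr do rewrite mulr_sumr.
rewrite exchange_big mulr_sumr; apply: eq_bigr => a _.
rewrite /fourier -mulrA mulr_suml; congr (_ * _).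
by apply: eq_bigr => y _; rewrite mulrA.
Qed.

Lemma fourier_unique (R : realType) n (f c : 'rV['F_2]_n -> R) :
  (forall x, f x = \sum_a c a * chi R a x) -> forall a, c a = fourier f a.
Proof.
move=> fE a; rewrite /fourier; under eq_bigr do rewrite fE mulr_suml.
rewrite exchange_big (bigD1 a) //= [X in _ + X]big1 => [|b ba].
  under eq_bigr do rewrite -mulrA (chiC R a).
  rewrite -mulr_sumr chi_orthogonal eqxx addr0 mulr1n mulrCA mulVf ?mulr1 //.
  by rewrite expf_neq0 // pnatr_eq0.
under eq_bigr do rewrite -mulrA (chiC R a) (chiC R b).
by rewrite -mulr_sumr chi_orthogonal (negPf ba) mulr0.
Qed.

(* Main.v *)
(** Write a, b for alpha, beta, and S for the support.  The claim is that S is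
    stable under translation by a + b.  Let T be the set of g in S \ {a, b}
    with g + a + b not in S, and C the rest of S \ {a, b}.  Replacing f by a
    translate, i.e. the coefficients c x by w x = c x * chi x y, we may assume
    w a * w b > 0.  Since f^2 = 1, the self-convolution of w is the indicator of
    0.  The hypothesis and the vanishing convolutions yield:
    - w a = w b, w (g + a + b) = - w g for g in C, and the sum of the w g ^ 2
      over C is 2 w a ^ 2;
    - for g in T, the set {x in T | x + a + g in S} consists of g, d, e with
      w g ^ 2 = w d ^ 2 = w e ^ 2 = w a ^ 2 and w g + w d + w e in
      {w a, - 3 w a}.
    With t = #|T| and u the sum of w over T, Parseval gives
    (4 + t) w a ^ 2 = 1, and counting triples gives 3 u = w a * (t - 4 N).  As
    2 w a + u = f y = +-1, we get 9 (4 + t) = (6 + t - 4 N) ^ 2.  Since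
    2 ^ n * w a is an integer, 4 + t is a power of 2; if t > 0 it is divisible
    by 8, whereas the square is then 4 modulo 8.  Hence t = 0. *)

Require Import Defs.
From mathcomp Require Import all_boot all_order all_algebra.
From mathcomp Require Import reals.
From mathcomp Require Import ring lra zify.

Set Implicit Arguments.
Unset Strict Implicit.
Unset Printing Implicit Defensive.

Import Order.TTheory GRing.Theory Num.Theory.

Local Open Scope ring_scope.

(** * Vectors over ['F_2]; ordered against unordered pairs *)

Ltac f2_vector :=
  let i := fresh "i" in
  apply/rowP => i; rewrite !mxE;
  repeat match goal with |- context [fun_of_matrix ?v ?z i] =>
    case: (F2P (fun_of_matrix v z i)) => -> end;
  by apply: val_inj.

(** The first entries of the ordered pairs in [S] with sum [g]; for [g != 0] there are twice as many
    as unordered pairs. *)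
Definition shift_inter n (S : {set 'rV['F_2]_n}) (g : 'rV['F_2]_n) :
  {set 'rV['F_2]_n} := [set x in S | x + g \in S].

Lemma in_shift_inter n (S : {set 'rV['F_2]_n}) g x :
  (x \in shift_inter S g) = (x \in S) && (x + g \in S).
Proof. by rewrite inE. Qed.

Lemma addvK2 n (g x : 'rV['F_2]_n) : x + g + g = x.
Proof. f2_vector. Qed.

Lemma addv_eq0 n (x y : 'rV['F_2]_n) : (x + y == 0) = (x == y).
Proof.
apply/eqP/eqP => [xy0|->]; last by f2_vector.
by rewrite -[x](addvK2 y) xy0 add0r.
Qed.

Lemma addv_eql n (x g : 'rV['F_2]_n) : (x + g == x) = (g == 0).
Proof. by rewrite -[RHS](inj_eq (addrI x)) addr0. Qed.

Lemma addv_eqC n (x y g : 'rV['F_2]_n) : (x + g == y) = (x == y + g).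
Proof. by rewrite -(inj_eq (addIr g)) addvK2. Qed.

Lemma card_pairs_summing_to (R : realType) n (f : 'rV['F_2]_n -> R) g :
  g != 0 ->
  #|shift_inter (fourier_support f) g| = (#|pairs_summing_to f g| * 2)%N.
Proof.
move=> g0; set S := fourier_support f; set P := pairs_summing_to f g.
have PP A : reflect (exists2 x, x \in shift_inter S g & A = [set x; x + g])
                    (A \in P).
  apply: (iffP imset2P) => [[x y xS]|[x]].
    rewrite inE => /andP[yS /andP[xy /eqP xyg]] ->.
    have yE : y = x + g by rewrite -xyg; f2_vector.
    by exists x; rewrite ?in_shift_inter -?yE //; apply/andP.
  rewrite in_shift_inter => /andP[xS xgS] ->; exists x (x + g) => //.
  rewrite inE xgS eq_sym addv_eql g0 /=; apply/eqP; f2_vector.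
(* The sets [[set x; x + g]] partition [shift_inter S g] into blocks of size two. *)
apply: card_uniform_partition.
  by move=> A /PP[x _ ->]; rewrite cards2 eq_sym addv_eql g0.
apply/and3P; split.
- apply/eqP/setP => x; apply/bigcupP/idP => [[A /PP[y yW ->]]|xW].
    case/set2P => -> //; move: yW; rewrite !in_shift_inter addvK2.
    by rewrite andbC.
  by exists [set x; x + g]; [apply/PP; exists x | rewrite set21].
- apply/trivIsetP => A B /PP[x _ ->] /PP[y _ ->] neAB.
  rewrite disjoint_subset; apply/subsetP => z zx; rewrite inE; apply/negP => zy.
  move/eqP: neAB; apply; suff E t : z \in [set t; t + g] ->
    [set t; t + g] = [set z; z + g] by rewrite (E x) // (E y).
  by case/set2P => -> //; rewrite addvK2 setUC.
- by apply/negP => /PP[x _ /setP/(_ x)]; rewrite !inE eqxx.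
Qed.

(** * Weights with vanishing self-convolution *)

Section Combinatorics.

Variables (R : realFieldType) (n : nat) (w : 'rV['F_2]_n -> R).
Variables (a b : 'rV['F_2]_n).

Let S := [set x | w x != 0].
Let T := [set x in S | [&& x != a, x != b & x + (a + b) \notin S]].

Hypothesis w_conv : forall g, g != 0 -> \sum_x w x * w (x + g) = 0.
Hypotheses (aS : a \in S) (bS : b \in S) (ab : a != b).
Hypothesis card4 : forall g, g \in S -> g != a -> g != b ->
  #|shift_inter S (a + g)| = 4%N.

Let memS x : (x \in S) = (w x != 0).
Proof. by rewrite inE. Qed.

Let memT x :
  (x \in T) = [&& x \in S, x != a, x != b & x + (a + b) \notin S].
Proof. by rewrite inE. Qed.

Let aag g : a + (a + g) = g. Proof. f2_vector. Qed.
Let gag g : g + (a + g) = a. Proof. f2_vector. Qed.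

Lemma sum_shift_inter g : g != 0 ->
  \sum_(x in shift_inter S g) w x * w (x + g) = 0.
Proof.
move=> g0; rewrite -[RHS](w_conv g0) [RHS](bigID (mem (shift_inter S g))) /=.
rewrite [X in _ = _ + X]big1 ?addr0 // => x.
rewrite in_shift_inter !memS negb_and !negbK.
by case/orP=> /eqP ->; rewrite ?mul0r ?mulr0.
Qed.

(** The four listed elements are distinct and lie in a set of size four. The convolution at [a + g]
    counts each of the two pairs twice, which gives the product relation. *)
Lemma quad g d : g \in S -> g != a -> g != b ->
  d \in S -> d + (a + g) \in S -> d != a -> d != g ->
  (shift_inter S (a + g) =i [:: a; g; d; d + (a + g)])
  /\ w a * w g = - (w d * w (d + (a + g))).
Proof.
move=> gS ga gb dS eS da dg.
have ag0 : a + g != 0 by rewrite addv_eq0 eq_sym.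
have ea : d + (a + g) != a by rewrite addv_eqC aag.
have eg : d + (a + g) != g by rewrite addv_eqC gag.
have ed : d + (a + g) != d by rewrite addv_eql.
have un : uniq [:: a; g; d; d + (a + g)].
  by rewrite /= !inE !negb_or !(eq_sym a) (eq_sym g d) (eq_sym g (d + _))
    (eq_sym d (d + _)) ga da ea dg eg ed.
have WE : shift_inter S (a + g) =i [:: a; g; d; d + (a + g)].
  apply: fsym; apply/subset_cardP; first by rewrite card4 //; apply/card_uniqP.
  apply/subsetP => x; rewrite in_shift_inter !inE -!memS.
  case/or4P=> /eqP ->; rewrite ?aag ?gag ?addvK2; exact/andP.
split=> //; have := sum_shift_inter ag0.
rewrite (eq_bigl _ _ WE) -big_uniq //= !big_cons big_nil aag gag addvK2.
lra.
Qed.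

Lemma exists_quad g : g \in S -> g != a -> g != b ->
  exists d, [/\ d \in S, d + (a + g) \in S, d != a & d != g].
Proof.
move=> gS ga gb; have : (0 < #|shift_inter S (a + g) :\: [set a; g]|)%N.
  rewrite cardsD card4 // subn_gt0.
  apply: leq_ltn_trans (subset_leq_card (subsetIr _ _)) _.
  by rewrite cards2; case: eqP.
case/card_gt0P=> d; rewrite in_setD in_shift_inter !inE negb_or -!memS -andbA.
by case/and4P; exists d.
Qed.

(** If [d + (a + b)] were in [S], then [b] would be one of the four elements for [a + d]. This
    forces [g + (a + b) = d], against [g \in T]. *)
Lemma quad_closed g d : g \in T ->
  d \in S -> d + (a + g) \in S -> d != a -> d != g ->
  d \in T /\ w a * w d = - (w g * w (d + (a + g))).
Proof.
rewrite memT => /and4P[gS ga gb nS] dS eS da dg.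
have db : d != b.
  apply: contraNneq nS => bd; move: eS; rewrite bd.
  by have -> : b + (a + g) = g + (a + b) by f2_vector.
have eE : g + (a + d) = d + (a + g) by f2_vector.
have := @quad d g dS da db gS; rewrite eE (eq_sym g d) => /(_ eS ga dg)[WE wE].
split; last by [].
rewrite memT dS da db /=; apply: contra nS => dabS.
have : b \in shift_inter S (a + d).
  rewrite in_shift_inter bS.
  by have -> : b + (a + d) = d + (a + b) by f2_vector.
rewrite WE !inE -!memS !(eq_sym b) (negPf ab) (negPf db) (negPf gb) /=.
move=> /eqP bE; suff -> : g + (a + b) = d by [].
by rewrite -bE; f2_vector.
Qed.

(** The four elements for [a + g] are [a] and a triple in [T]; [quad_closed] at [d] and at
    [e = d + (a + g)] gives the last two relations. *)
Lemma triple g : g \in T ->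
  exists d e, [/\ d \in T, e \in T, uniq [:: g; d; e],
    [set x in T | x + (a + g) \in S] =i [:: g; d; e] &
    [/\ w a * w g = - (w d * w e), w a * w d = - (w g * w e)
      & w a * w e = - (w g * w d)]].
Proof.
move=> gT; have := gT; rewrite memT => /and4P[gS ga gb nS].
have [d [dS eS da dg]] := exists_quad gS ga gb.
have [WE wgE] := quad gS ga gb dS eS da dg.
have [dT wdE] := quad_closed gT dS eS da dg.
have ea : d + (a + g) != a by rewrite addv_eqC aag.
have eg : d + (a + g) != g by rewrite addv_eqC gag.
have ed : d + (a + g) != d by rewrite addv_eql addv_eq0 eq_sym.
have [|eT weE] := quad_closed gT eS _ ea eg; first by rewrite addvK2.
rewrite addvK2 in weE.
exists d, (d + (a + g)); split=> //.
  by rewrite /= !inE !negb_or !(eq_sym g) (eq_sym d (d + _)) dg eg ed.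
move=> x; rewrite inE; apply/andP/idP => [[xT xS]|].
  have : x \in shift_inter S (a + g).
    by rewrite in_shift_inter xS andbT; move: xT; rewrite memT => /andP[].
  rewrite WE inE => /orP[/eqP xa|//].
  by move: xT; rewrite xa memT eqxx andbF.
rewrite !inE -!memS => /or3P[] /eqP ->; rewrite ?gag ?addvK2 //; split=> //.
all: by rewrite -memT.
Qed.

(** * The weights at [a], at [b] and on [C] *)

Let C := [set x in S | [&& x != a, x != b & x + (a + b) \in S]].

Let memC x :
  (x \in C) = [&& x \in S, x != a, x != b & x + (a + b) \in S].
Proof. by rewrite inE. Qed.

Let aab : a + (a + b) = b. Proof. f2_vector. Qed.
Let bab : b + (a + b) = a. Proof. f2_vector. Qed.

Lemma mem_C_shift x : (x + (a + b) \in C) = (x \in C).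
Proof.
rewrite !memC addvK2 !addv_eqC aab bab.
by case: (x \in S); case: (_ + _ \in S); case: (x == a); case: (x == b).
Qed.

Lemma sum_C_shift (F : 'rV['F_2]_n -> R) :
  \sum_(x in C) F (x + (a + b)) = \sum_(x in C) F x.
Proof.
rewrite [RHS](reindex_inj (addIr (a + b))) /=.
by apply: eq_bigl => x; rewrite mem_C_shift.
Qed.

Lemma sum_support (F : 'rV['F_2]_n -> R) : (forall x, w x = 0 -> F x = 0) ->
  \sum_x F x = F a + F b + \sum_(x in C) F x + \sum_(x in T) F x.
Proof.
move=> F0; rewrite (bigD1 a) //= (bigD1 b) 1?eq_sym //= -!addrA.
congr (_ + (_ + _)); rewrite (bigID (mem S)) /= [X in _ + X]big1 ?addr0.
  rewrite (bigID (fun x => x + (a + b) \in S)) /=.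
  congr (_ + _); apply: eq_bigl => x; rewrite ?memC ?memT;
  by case: (x \in S); rewrite ?andbT ?andbF -?andbA.
by move=> x /andP[_]; rewrite memS negbK => /eqP/F0.
Qed.

(** This is [quad] with [d = b], whose fourth element is [g + (a + b)]. *)
Lemma pair_C g : g \in C -> w a * w g = - (w b * w (g + (a + b))).
Proof.
rewrite memC => /and4P[gS ga gb g'S].
have E : b + (a + g) = g + (a + b) by f2_vector.
have := @quad g b gS ga gb bS; rewrite E (eq_sym b a) (eq_sym b g).
by case/(_ g'S ab gb).
Qed.

Hypothesis w_ab : 0 < w a * w b.

(** In the convolution at [a + b], the terms outside [C] are those of [a] and [b]. *)
Lemma sum_C_conv : \sum_(x in C) w x * w (x + (a + b)) = - (w a * w b *+ 2).
Proof.
have := sum_shift_inter (g := a + b); rewrite addv_eq0 => /(_ ab).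
rewrite (bigD1 a) /= ?in_shift_inter ?aab ?aS // (bigD1 b) /=; last first.
  by rewrite in_shift_inter bab aS bS eq_sym.
rewrite bab (eq_bigl (mem C)) => [|x]; first lra.
rewrite in_shift_inter [RHS]memC.
by case: (x \in S); case: (_ + _ \in S); case: (x == a); case: (x == b).
Qed.

(** [pair_C] at [g] and at its translate gives equal squares, and [w_ab] fixes the sign. For empty
    [C], [sum_C_conv] would give [w a * w b = 0]. *)
Lemma eq_w_ab : w a = w b.
Proof.
have [C0|[g gC]] := set_0Vmem C.
  by have := sum_C_conv; rewrite C0 big_set0; move: w_ab; lra.
have wg : w g != 0 by rewrite -memS; move: gC; rewrite memC => /and4P[].
have := pair_C gC; have := @pair_C (g + (a + b)).
rewrite mem_C_shift addvK2 => /(_ gC) E1 E2.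
have : w g * ((w a - w b) * (w a + w b)) = 0.
  have : w a * (w a * w g) = w a * - (w b * w (g + (a + b))) by rewrite E2.
  have : w b * (w a * w (g + (a + b))) = w b * - (w b * w g) by rewrite E1.
  lra.
move/eqP; rewrite !mulf_eq0 (negPf wg) /= => /orP[].
  by rewrite subr_eq0 => /eqP.
by rewrite addr_eq0 => /eqP E; move: w_ab; rewrite E; nra.
Qed.

Lemma wa_neq0 : w a != 0. Proof. by rewrite -memS. Qed.

Lemma w_C_shift g : g \in C -> w (g + (a + b)) = - w g.
Proof.
move/pair_C; rewrite -eq_w_ab -mulrN => /(mulfI wa_neq0) ->.
by rewrite opprK.
Qed.

(** Translation by [a + b] permutes [C] and reverses the sign of [w]. *)
Lemma sum_C : \sum_(x in C) w x = 0.
Proof.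
have := sum_C_shift w.
rewrite (eq_bigr _ w_C_shift) sumrN; lra.
Qed.

Lemma sum_C_sqr : \sum_(x in C) w x ^+ 2 = w a ^+ 2 *+ 2.
Proof.
have := sum_C_conv.
rewrite (eq_bigr (fun x => - (w x ^+ 2))) => [|x /w_C_shift ->].
  by rewrite sumrN -eq_w_ab; lra.
by rewrite mulrN.
Qed.

(** * The weights on [T] and the equation for its cardinality *)

Lemma sqr_T g : g \in T -> w g ^+ 2 = w a ^+ 2.
Proof.
move=> gT; have [d [e [dT eT _ _ [_ E1 E2]]]] := triple gT.
have [wd we] : w d != 0 /\ w e != 0.
  by rewrite -!memS; move: dT eT; rewrite !memT => /and4P[-> _ _ _] /and4P[->].
(* The relations for [d] and [e] are multiplied; the nonzero factor [w d * w e] then cancels. *)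
have : (w d * w e) * (w g ^+ 2 - w a ^+ 2) = 0.
  have : (w a * w d) * (w a * w e) = w g * w e * (w g * w d).
    by rewrite E1 E2 mulrNN.
  lra.
by move/eqP; rewrite !mulf_eq0 (negPf wd) (negPf we) /= subr_eq0 => /eqP.
Qed.

Lemma sum_triple g : g \in T -> exists k : bool,
  \sum_(x in T | x + (a + g) \in S) w x = w a * (1 - 4 * k%:R).
Proof.
move=> gT; have [d [e [dT eT un tE [E1 E2 E3]]]] := triple gT.
rewrite (eq_bigl (mem [:: g; d; e])) => [|x]; last first.
  by have := tE x; rewrite inE.
rewrite -big_uniq //= !big_cons big_nil addr0.
have wa := wa_neq0.
(* The three weights are [w a] up to sign, with an odd number of minus signs by [E3]: one gives the
   sum [w a], three give [- 3 w a]. *)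
have /eqP := sqr_T gT; have /eqP := sqr_T dT.
rewrite !eqf_sqr => /orP[]/eqP dE /orP[]/eqP gE; move: E3; rewrite gE dE.
- rewrite -mulrN => /(mulfI wa) ->; exists false; rewrite /=; lra.
- rewrite mulNr opprK => /(mulfI wa) ->; exists false; rewrite /=; lra.
- rewrite mulrN opprK => /(mulfI wa) ->; exists false; rewrite /=; lra.
- rewrite mulrNN -mulrN => /(mulfI wa) ->; exists true; rewrite /=; lra.
Qed.

Lemma sum_T : exists N : nat,
  3 * \sum_(x in T) w x = w a * (#|T|%:R - 4 * N%:R).
Proof.
(* Double counting: [x + (a + g) \in S] is symmetric in [x] and [g], so each [x] in [T] occurs in
   exactly three inner sums. *)
have -> : 3 * \sum_(x in T) w x =
    \sum_(g in T) \sum_(x in T | x + (a + g) \in S) w x.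
  rewrite (exchange_big_dep (mem T)) /= => [|g x _ /andP[]//].
  rewrite mulr_sumr; apply: eq_bigr => x xT; rewrite sumr_const -[RHS]mulr_natl.
  have [d [e [_ _ un tE _]]] := triple xT; congr (_%:R * _).
  have <- : #|[:: x; d; e]| = 3%N by apply/card_uniqP.
  rewrite -(eq_card tE); apply: eq_card => y.
  rewrite inE [RHS]unfold_in /= xT; congr (_ && (_ \in S)); f2_vector.
(* [N] counts the [g] whose triple has sum [- 3 w a]. *)
suff H (P : pred 'rV['F_2]_n) (F : 'rV['F_2]_n -> R) :
  (forall g, P g -> exists k : bool, F g = w a * (1 - 4 * k%:R)) ->
  exists N : nat, \sum_(g | P g) F g = w a * (\sum_(g | P g) 1 - 4 * N%:R).
  by have [N ->] := H (mem T) _ sum_triple; exists N; rewrite sumr_const.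
move=> HF; elim/big_rec2: _ => [|g x y Pg [N ->]]; first by exists 0%N; lra.
have [k ->] := HF g Pg; exists (k + N)%N; rewrite natrD; lra.
Qed.

Hypotheses (w_sqr : \sum_x w x ^+ 2 = 1) (w_sum : (\sum_x w x) ^+ 2 = 1).

Lemma wa_sqr : (4 + #|T|)%:R * w a ^+ 2 = 1.
Proof.
rewrite -[RHS]w_sqr sum_support => [|x ->]; last by rewrite expr0n.
rewrite sum_C_sqr (eq_bigr _ sqr_T) sumr_const -eq_w_ab natrD -[in RHS]mulr_natl; lra.
Qed.

Lemma card_T_sqr : exists N : nat,
  (9 * (4 + #|T|%:Z) = (6 + #|T|%:Z - 4 * N%:Z) ^+ 2)%R.
Proof.
have [N TE] := sum_T; exists N.
apply/eqP; rewrite -(eqr_int R) rmorphXn /= rmorphM !rmorphD /= rmorphN rmorphM /=.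
rewrite !pmulrn.
have wE : 3 * \sum_x w x = w a * (6 + #|T|%:R - 4 * N%:R).
  rewrite sum_support // sum_C -eq_w_ab; lra.
apply/eqP; have wa : w a ^+ 2 != 0 by rewrite expf_neq0 // wa_neq0.
(* Multiplied by [w a ^+ 2], both sides become 9: the left by [wa_sqr], the right by the square of
   [wE]. *)
apply: (mulIf wa).
have := congr1 (fun r => r ^+ 2) wE; rewrite !exprMn w_sum => E.
have := wa_sqr; rewrite natrD; move: E; rewrite !pmulrn; lra.
Qed.

End Combinatorics.

(** * Arithmetic of the cardinality equation *)

Lemma granular_square (t N n : nat) (m : int) :
  (4 + t%:Z) * m ^+ 2 = 2 ^+ (n * 2) ->
  9 * (4 + t%:Z) = (6 + t%:Z - 4 * N%:Z) ^+ 2 -> t = 0%N.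
Proof.
move=> tm tN; have : (4 + t %| 2 ^ (n * 2))%N.
  by have := congr1 absz tm; rewrite abszM !abszX => <-; apply: dvdn_mulr.
case/(dvdn_pfactor _ _ (isT : prime 2)) => e _ te.
case: t => [//|t] in tm tN te *.
(* Here [t] is the predecessor of the cardinality, so the power is at least 5 and hence divisible by
   8. The base of the square is then 2 modulo 4. *)
by case: e te => [|[|[|e]]]; rewrite ?expn0 ?expn1 ?expnS; lia.
Qed.

(** * Characters and Fourier coefficients of Boolean functions *)

Lemma chi0l (R : realType) n (x : 'rV['F_2]_n) : chi R 0 x = 1.
Proof. by rewrite /chi big1 // => i _; rewrite mxE mul0r. Qed.

Lemma chiDl (R : realType) n (a b x : 'rV['F_2]_n) :
  chi R (a + b) x = chi R a x * chi R b x.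
Proof. by rewrite chiC chiDr !(chiC R x). Qed.

Lemma chi_sqr (R : realType) n (a x : 'rV['F_2]_n) : chi R a x ^+ 2 = 1.
Proof. by rewrite /chi -exprM mulnC exprM sqrrN expr1n expr1n. Qed.

(** As functions of [g], both sides are the Fourier coefficients of [f ^ 2 = 1]. *)
Lemma fourier_conv (R : realType) n (f : 'rV['F_2]_n -> R) g :
  boolean_valued f ->
  \sum_x fourier f x * fourier f (x + g) = (g == 0)%:R.
Proof.
move=> fB; pose one (x : 'rV['F_2]_n) : R := 1.
rewrite [LHS](fourier_unique (f := one)
  (c := fun g => \sum_x fourier f x * fourier f (x + g))) => [|x].
  rewrite -(fourier_unique (f := one) (c := fun g => (g == 0)%:R)) // => x.
  rewrite (bigD1 0) //= eqxx mul1r big1 => [|i /negPf ->]; last by rewrite mul0r.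
  by rewrite addr0 chi0l.
have -> : one x = f x * f x by case: (fB x) => ->; rewrite ?mulrNN mulr1.
rewrite {1}[f x]fourier_expansion mulr_suml.
under [RHS]eq_bigr do rewrite mulr_suml.
rewrite [RHS]exchange_big; apply: eq_bigr => y _ /=.
(* The inner index becomes [y + h], and the square of the character of [y] is 1. *)
rewrite [f x]fourier_expansion mulr_sumr (reindex_inj (addrI y)) /=.
apply: eq_bigr => h _; rewrite chiDl.
have := chi_sqr R y x; set u := chi _ y _ => u2.
by rewrite -[RHS]mul1r -u2; ring.
Qed.

Lemma fourier_granular (R : realType) n (f : 'rV['F_2]_n -> R) a :
  boolean_valued f -> exists m : int, 2 ^+ n * fourier f a = m%:~R.
Proof.
move=> fB; apply/intrP; rewrite /fourier mulrA mulfV ?mul1r; last first.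
  by rewrite expf_neq0 // pnatr_eq0.
apply: rpred_sum => x _; rewrite rpredM //; last by rewrite /chi rpredX // rpredN rpred1.
by case: (fB x) => ->; rewrite ?rpredN rpred1.
Qed.

(** The point 0 keeps the sign of [r]; a unit vector at a coordinate where [a] and [b] differ
    reverses it. *)
Lemma exists_sign_point (R : realType) n (a b : 'rV['F_2]_n) (r : R) :
  r != 0 -> a != b -> exists y, 0 < r * (chi R a y * chi R b y).
Proof.
move=> r0; rewrite -addv_eq0 => /rV0Pn[i abi].
have [r_gt0|] := ltP 0 r.
  by exists 0; rewrite -chiDl chiC chi0l mulr1.
rewrite le_eqVlt (negPf r0) /= => r_lt0; exists (delta_mx 0 i).
by rewrite -chiDl chi_delta // mulrN1 oppr_gt0.
Qed.

(** * Stability of the support under translation *)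

Lemma shift_closed (R : realType) n (f : 'rV['F_2]_n -> R)
    (S := fourier_support f) a b :
  boolean_valued f -> a \in S -> b \in S -> a != b ->
  (forall g, g \in S -> g != a -> g != b -> #|shift_inter S (a + g)| = 4%N) ->
  shift_inter S (a + b) = S.
Proof.
move=> fB aS bS ab card4.
have memS x : (x \in S) = (fourier f x != 0) by rewrite inE.
have [||y y_pos] := @exists_sign_point R n a b (fourier f a * fourier f b).
- by rewrite mulf_neq0 -?memS.
- by [].
(* These are the Fourier coefficients of the translate of [f] by [y]; their sum is [f y]. *)
pose w x := fourier f x * chi R x y.
have chi0 x : chi R x y != 0 by rewrite -sqrf_eq0 chi_sqr oner_eq0.
have SE : [set x | w x != 0] = S.
  by apply/setP => x; rewrite memS inE mulf_eq0 (negPf (chi0 x)) orbF.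
have w_conv g : \sum_x w x * w (x + g) = (g == 0)%:R.
  rewrite (eq_bigr (fun x => (fourier f x * fourier f (x + g)) * chi R g y)).
    rewrite -mulr_suml fourier_conv //; have [->|] := eqVneq; last by rewrite mul0r.
    by rewrite mul1r chi0l.
  move=> x _; rewrite /w chiDl -[RHS]mul1r -(chi_sqr R x y); ring.
have w_conv0 g : g != 0 -> \sum_x w x * w (x + g) = 0.
  by rewrite w_conv => /negPf ->.
have w_sqr : \sum_x w x ^+ 2 = 1.
  have := w_conv 0; rewrite eqxx => E; rewrite -[RHS]E.
  by apply: eq_bigr => x _; rewrite addr0.
have w_sum : (\sum_x w x) ^+ 2 = 1.
  by rewrite -fourier_expansion; case: (fB y) => ->; rewrite ?sqrrN expr1n.
have w_ab : 0 < w a * w b by rewrite /w mulrACA.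
rewrite -SE in aS bS card4 *.
have [N TN] := card_T_sqr w_conv0 aS bS ab card4 w_ab w_sqr w_sum.
have wa2 := wa_sqr w_conv0 aS bS ab card4 w_ab w_sqr.
have [m mE] := fourier_granular a fB.
move: wa2 TN; set T := [set x in _ | _] => wa2 TN.
have/cards0_eq T0 : #|T| = 0%N.
  apply: (granular_square (n := n) (m := m) _ TN).
  (* [w a] and [fourier f a] have equal squares, so [wa2] multiplied by [2 ^ (n * 2)] becomes the
     integer identity. *)
  apply/eqP; rewrite -(eqr_int R) rmorphM !rmorphXn /= -mE.
  have wa : w a ^+ 2 = fourier f a ^+ 2 by rewrite exprMn chi_sqr mulr1.
  rewrite wa in wa2; rewrite exprMn -exprM rmorphD /= mulrCA.
  by move: wa2; rewrite natrD pmulrn => ->; rewrite mulr1.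
apply/setP => x; rewrite in_shift_inter; case xS : (x \in _) => //=.
have [->|xa] := eqVneq x a.
  by have -> : a + (a + b) = b by f2_vector.
have [->|xb] := eqVneq x b.
  by have -> : b + (a + b) = a by f2_vector.
have : x \in T = false by rewrite T0 inE.
by rewrite inE xS xa xb => /negbFE.
Qed.

(** * An example in two variables *)

Lemma sum_rV2 (R : realType) (F : 'rV['F_2]_2 -> R) :
  \sum_x F x = F (\row_i 0) + F (\row_i (i == 1)%:R) +
               F (\row_i (i == 0)%:R) + F (\row_i 1).
Proof.
pose h (p : 'F_2 * 'F_2) : 'rV['F_2]_2 := \row_i (if i == 0 then p.1 else p.2).
rewrite (reindex h) /=; last first.
  exists (fun x => (x 0 0, x 0 1)) => [[u v] _|x _]; first by rewrite !mxE.
  apply/rowP => i; rewrite mxE.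
  by case: i => [[|[|]]] // ? /=; congr (x _ _); apply: val_inj.
rewrite -(pair_bigA _ (fun u v => F (h (u, v)))) /= !big_ord_recl !big_ord0 /=.
rewrite !addr0 addrA.
congr (F _ + F _ + F _ + F _); apply/rowP => i; rewrite !mxE;
  by case: i => [[|[|]]] // ?; apply: val_inj.
Qed.

(** The product of the two coordinates gives a bent function: all four coefficients are 1/2 up to
    sign. *)
Lemma exists_boolean_full_support (R : realType) :
  exists2 f : 'rV['F_2]_2 -> R, boolean_valued f & fourier_support f = setT.
Proof.
pose f (x : 'rV['F_2]_2) : R := (-1) ^+ (x 0 0 * x 0 1 : 'F_2)%R.
exists f => [x|].
  by rewrite /f; case: (F2P (x 0 0 * x 0 1)) => ->; [right | left].
apply/setP => a; rewrite !inE /fourier mulf_neq0 //.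
  by rewrite invr_eq0 expf_neq0 // pnatr_eq0.
have lift1 : lift ord0 ord0 = 1 :> 'I_2 by apply: val_inj.
rewrite sum_rV2 /f /chi !big_ord_recl !big_ord0 !mxE lift1 /=.
case: (F2P (a 0 0)) => ->; case: (F2P (a 0 1)) => ->;
  by rewrite /= ?expr0 ?expr1; apply/eqP; lra.
Qed.

Theorem theorem4 (R : realType) :
  (exists (n : nat) (f : 'rV['F_2]_n -> R),
     boolean_valued f /\
     exists alpha beta : 'rV['F_2]_n,
       [/\ alpha \in fourier_support f, beta \in fourier_support f,
           alpha != beta &
           forall gamma : 'rV['F_2]_n,
             gamma \in fourier_support f :\: [set alpha; beta] ->
             #|pairs_summing_to f (alpha + gamma)| = 2%N])
  /\
  (forall (n : nat) (f : 'rV['F_2]_n -> R),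
     boolean_valued f ->
     forall alpha beta : 'rV['F_2]_n,
       alpha \in fourier_support f ->
       beta \in fourier_support f ->
       alpha != beta ->
       (forall gamma : 'rV['F_2]_n,
          gamma \in fourier_support f :\: [set alpha; beta] ->
          #|pairs_summing_to f (alpha + gamma)| = 2%N) ->
       #|pairs_summing_to f (alpha + beta)|%:R
         = #|fourier_support f|%:R / 2 :> rat).
Proof.
split=> [|n f fB a b aS bS ab O2].
  have [f fB fS] := exists_boolean_full_support R.
  (* With full support, each nonzero [g] is the sum of four ordered pairs, hence of two unordered
     ones. *)
  exists 2%N, f; split=> //; exists 0, (const_mx 1); rewrite fS !inE; split=> //.
    by apply/eqP => /rowP/(_ 0); rewrite !mxE.
  move=> g; rewrite !inE negb_or add0r => /andP[/andP[g0 _] _].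
  have := card_pairs_summing_to f g0; rewrite fS => E.
  suff : (#|pairs_summing_to f g| * 2)%N = 4 by lia.
  rewrite -E (_ : shift_inter _ _ = setT) ?cardsT ?card_mx ?card_Fp //.
  by apply/setP => x; rewrite !inE.
have a_neq g : a != g -> a + g != 0 by rewrite addv_eq0.
have := card_pairs_summing_to f (a_neq b ab).
(* Every element of the support starts an ordered pair with sum [a + b], so [k] is twice the number
   of unordered pairs. *)
rewrite shift_closed // => [->|g gS ga gb]; first by rewrite natrM mulfK.
rewrite card_pairs_summing_to ?O2 ?a_neq 1?eq_sym //.
by rewrite in_setD in_set2 negb_or ga gb.
Qed.
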